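(* Let $K$ be a commutative ring with unity, $v,w:\mathbb Z\to K$, and $\alpha,\beta\in\mathbb Z$. With the $\mathcal V$-Stirling numbers as defined in the context, for all integers $m_1,m_2,n\ge 0$, $$c^{\mathcal V}_{\alpha,\beta}[m_1+m_2,n]=\sum_{k=0}^{n}c^{\mathcal V}_{\alpha+m_2,\beta}[m_1,n-k]\,c^{\mathcal V}_{\alpha,\beta+m_1}[m_2,k],$$ $$S^{\mathcal V}_{\alpha,\beta}[m_1+m_2,n]=\sum_{k=0}^{n}S^{\mathcal V}_{\alpha+k,\beta}[m_1,n-k]\,S^{\mathcal V}_{\alpha,\beta+n-k}[m_2,k].$$
   Context: Let $K$ be a commutative ring with unity and $v,w:\mathbb Z\to K$ functions; write $v_i=v(i)$, $w_i=w(i)$ and $\mathcal V=(v,w)$. For finitely many variables, $e_t$ denotes the $t$-th elementary symmetric function and $h_t$ the $t$-th complete homogeneous symmetric function, with $e_0=h_0=1$ and $e_t=h_t=0$ for $t<0$ (and $e_t=0$ when $t$ exceeds the number of variables). For $\alpha,\beta\in\mathbb Z$ and integers $n,k\ge 0$ define $$c^{\mathcal V}_{\alpha,\beta}[n,k]=e_{n-k}\big(v_{\alpha+n-1}w_{\beta},v_{\alpha+n-2}w_{\beta+1},\ldots,v_{\alpha}w_{\beta+n-1}\big)$$ (the $n$ arguments $v_{\alpha+n-1-i}w_{\beta+i}$, $0\le i\le n-1$), and $$S^{\mathcal V}_{\alpha,\beta}[n,k]=h_{n-k}\big(v_{\alpha+k}w_{\beta},v_{\alpha+k-1}w_{\beta+1},\ldots,v_{\alpha}w_{\beta+k}\big)$$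 (the $k+1$ arguments $v_{\alpha+k-i}w_{\beta+i}$, $0\le i\le k$). In particular both vanish when $k>n$. If $n<0$ or $k<0$, both are defined to be $0$. *)

(* Defs.v *)
From mathcomp Require Import all_boot all_order all_algebra.

Set Implicit Arguments.
Unset Strict Implicit.
Unset Printing Implicit Defensive.

Import GRing.Theory.
Local Open Scope ring_scope.

(* K is a comPzRingType, so the zero ring is allowed; this is why the
   symmetric functions are not taken from {mpoly K[m]}, which requires a
   nontrivial ring. *)

Definition elem_sym (K : comPzRingType) (m : nat) (t : int) (x : 'I_m -> K) : K :=
  if t is Posz d then \sum_(A : {set 'I_m} | #|A| == d) \prod_(i in A) x i
  else 0.

(* The sum ranges over the exponent vectors a of the monomials of degree d;
   exponents are at most d, hence the codomain 'I_d.+1. *)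
Definition comp_hom_sym (K : comPzRingType) (m : nat) (t : int) (x : 'I_m -> K) : K :=
  if t is Posz d then
    \sum_(a : {ffun 'I_m -> 'I_d.+1} | (\sum_i a i)%N == d)
      \prod_i x i ^+ a i
  else 0.

Definition stirling1 (K : comPzRingType) (v w : int -> K) (al be : int)
    (n k : nat) : K :=
  elem_sym (n%:Z - k%:Z)
    (fun i : 'I_n => v (al + n%:Z - 1 - i%:Z) * w (be + i%:Z)).

Definition stirling2 (K : comPzRingType) (v w : int -> K) (al be : int)
    (n k : nat) : K :=
  comp_hom_sym (n%:Z - k%:Z)
    (fun i : 'I_k.+1 => v (al + k%:Z - i%:Z) * w (be + i%:Z)).

(* Main.v *)
(** A Stirling number of either kind is a weighted count of lattice paths making
    [m] steps, [n] of them up: a step up has weight 1 and the remaining steps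
    carry the variables.  For the first kind the variable used depends on the
    number of steps already made, for the second kind on the height already
    reached.  Both identities are obtained by cutting a path with [m1 + m2]
    steps after its first [m1] steps. *)

Require Import Defs.
From mathcomp Require Import all_boot all_order all_algebra.
From mathcomp Require Import zify.

Import GRing.Theory.
Local Open Scope ring_scope.

Section PathSum.
Variable K : comPzRingType.
Implicit Types (x : nat -> nat -> K) (m n : nat).

(* [x i j] is the weight of a horizontal step made after [i] steps, at height
   [j]. *)
Fixpoint path_sum x m n : K :=
  match m, n with
  | 0, n => (n == 0)%:R
  | m'.+1, 0 => x 0%N 0%N * path_sum (fun i => x i.+1) m' 0
  | m'.+1, n'.+1 => x 0%N 0%N * path_sum (fun i => x i.+1) m' n'.+1
                    + path_sum (fun i j => x i.+1 j.+1) m' n'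
  end.

Lemma path_sum_cat x m1 m2 n :
  path_sum x (m1 + m2) n =
    \sum_(j < n.+1) path_sum x m1 j *
      path_sum (fun a b => x (m1 + a) (j + b))%N m2 (n - j).
Proof.
elim: m1 n x => [|m1 IH] n x.
  rewrite add0n big_ord_recl /= mul1r subn0 big1 ?addr0 // => i _.
  by rewrite mul0r.
case: n => [|n].
  rewrite addSn /= IH !big_ord_recl !big_ord0 !addr0 /= mulrA; congr (_ * _).
rewrite addSn /= !IH.
(* A path at height 0 at the cut cannot begin with an up step, so that summand is isolated; each
   remaining one splits by its first step. *)
rewrite [RHS]big_ord_recl [X in _ * X]big_ord_recl mulrDr -addrA /= !mulrA.
congr (_ + _); rewrite mulr_sumr -big_split /=.
by apply: eq_bigr => i _; rewrite mulrDl mulrA subSS.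
Qed.
End PathSum.

Section GradedSum.
Variables (K : comPzRingType) (T : finType) (c : T -> nat).
Implicit Types (d : nat) (x : nat -> K).

(** A common form of both symmetric functions, so that variables are peeled off only once: exponents
    0 and 1, indexed by [bool], give the elementary one; exponents in ['I_d.+1] give the complete
    homogeneous one. *)
Definition graded_sum m d x : K :=
  \sum_(f : {ffun 'I_m -> T} | (\sum_i c (f i))%N == d)
    \prod_(i < m) x i ^+ c (f i).

Lemma graded_sum0 d x : graded_sum 0 d x = (d == 0)%:R.
Proof.
rewrite /graded_sum; under eq_bigl do rewrite big_ord0 eq_sym.
under eq_bigr do rewrite big_ord0.
case: d => [|d] /=; last by rewrite big_pred0_eq.
by rewrite sumr_const card_ffun !card_ord expn0.
Qed.

Lemma graded_sumS m d x :
  graded_sum m.+1 d x =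
    \sum_(t | (c t <= d)%N) x 0%N ^+ c t *
      graded_sum m (d - c t) (fun i => x i.+1).
Proof.
(* A choice of exponents for [m.+1] variables is a pair: the exponent of the first variable and a
   choice for the others. *)
pose cons_ffun (p : T * {ffun 'I_m -> T}) : {ffun 'I_m.+1 -> T} :=
  [ffun i => oapp p.2 p.1 (unlift ord0 i)].
have cons0 p : cons_ffun p ord0 = p.1 by rewrite ffunE unlift_none.
have consS p i : cons_ffun p (lift ord0 i) = p.2 i by rewrite ffunE liftK.
have cons_bij : bijective cons_ffun.
  exists (fun f : {ffun 'I_m.+1 -> T} =>
    (f ord0, [ffun i : 'I_m => f (lift ord0 i)])) => [[t g]|f].
    by rewrite cons0; congr (_, _); apply/ffunP => i; rewrite ffunE consS.
  apply/ffunP => i; case: (unliftP ord0 i) => [j|] ->.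
    by rewrite consS ffunE.
  by rewrite cons0.
rewrite /graded_sum (reindex cons_ffun) /=; last exact: onW_bij.
under [RHS]eq_bigr do rewrite mulr_sumr.
rewrite pair_big_dep /=; apply: eq_big => [[t g]|[t g] _] /=.
  rewrite big_ord_recl cons0 /=; under eq_bigr do rewrite consS.
  by rewrite /=; set s := (\sum_(i < m) _)%N; lia.
rewrite big_ord_recl cons0; congr (_ * _).
by apply: eq_bigr => i _; rewrite consS.
Qed.
End GradedSum.

Section SymmetricFunctions.
Variable K : comPzRingType.
Implicit Types (x : nat -> K) (m n d : nat) (t : int).

Lemma eq_elem_sym m t (f g : 'I_m -> K) :
  f =1 g -> elem_sym t f = elem_sym t g.
Proof.
by case: t => // d fg; apply: eq_bigr => A _; apply: eq_bigr => i _.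
Qed.

Lemma eq_comp_hom_sym m t (f g : 'I_m -> K) :
  f =1 g -> comp_hom_sym t f = comp_hom_sym t g.
Proof.
move=> fg; case: t => // d; apply: eq_bigr => a _.
by apply: eq_bigr => i _; rewrite fg.
Qed.

Lemma elem_sym_graded m d x :
  elem_sym d (fun i : 'I_m => x i) = graded_sum K bool nat_of_bool m d x.
Proof.
rewrite /elem_sym /graded_sum.
rewrite (reindex (fun f : {ffun 'I_m -> bool} => [set i | f i])) /=; last first.
  apply: onW_bij; exists (fun A : {set 'I_m} => [ffun i => i \in A]) => [f|A].
    by apply/ffunP => i; rewrite ffunE inE.
  by apply/setP => i; rewrite inE ffunE.
apply: eq_big => [f|f _].
  rewrite -sum1_card big_mkcond /=; congr (_ == _).
  by apply: eq_bigr => i _; rewrite inE; case: (f i).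
by rewrite big_mkcond; apply: eq_bigr => i _; rewrite inE; case: (f i).
Qed.

Lemma elem_sym0 t x : elem_sym t (fun i : 'I_0 => x i) = (t == 0)%:R.
Proof. by case: t => // d; rewrite elem_sym_graded graded_sum0. Qed.

Lemma elem_symS m t x :
  elem_sym t (fun i : 'I_m.+1 => x i) =
    x 0%N * elem_sym (t - 1) (fun i : 'I_m => x i.+1)
    + elem_sym t (fun i : 'I_m => x i.+1).
Proof.
case: t => [[|d]|d].
- rewrite [elem_sym (_ - 1) _]/= mulr0 add0r elem_sym_graded.
  rewrite (elem_sym_graded _ _ (fun i => x i.+1)) graded_sumS.
  by rewrite big_mkcond big_bool /= add0r mul1r.
- rewrite -[in d.+1%:Z - 1]addn1 PoszD addrK elem_sym_graded.
  rewrite !(elem_sym_graded _ _ (fun i => x i.+1)) graded_sumS.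
  by rewrite big_mkcond big_bool /= mul1r subn0 subn1.
- by rewrite /= mulr0 addr0.
Qed.

Lemma elem_sym_large m d x :
  (m < d)%N -> elem_sym d (fun i : 'I_m => x i) = 0.
Proof.
move=> md; rewrite /elem_sym big_pred0 // => A; apply/negbTE.
by rewrite neq_ltn (leq_ltn_trans (max_card A)) // card_ord.
Qed.

(** In [comp_hom_sym] the exponent type depends on the degree. Peeling off a variable lowers the
    degree but not the type; this adjusts the type, as no exponent exceeds the total degree. *)
Lemma graded_sum_ord_bound B m d x :
  (d <= B)%N ->
  graded_sum K 'I_B.+1 (@nat_of_ord _) m d x =
  graded_sum K 'I_d.+1 (@nat_of_ord _) m d x.
Proof.
elim: m B d x => [|m IH] B d x dB; first by rewrite !graded_sum0.
rewrite !graded_sumS (big_ord_widen_cond B.+1 (fun e => e <= d)%N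
  (fun e => x 0%N ^+ e * graded_sum K 'I_d.+1 (@nat_of_ord _) m (d - e) _)) //.
apply: eq_big => [e|e ed]; first by rewrite ltnS andbb.
by congr (_ * _); rewrite IH 1?[RHS]IH // ?leq_subr // (leq_trans (leq_subr _ _)).
Qed.

Lemma comp_hom_sym0 t x : comp_hom_sym t (fun i : 'I_0 => x i) = (t == 0)%:R.
Proof. by case: t => // d; exact: graded_sum0. Qed.

(** Monomials are sorted by divisibility by [x 0]. Unlike in [elem_symS], the quotient may contain
    [x 0] again, so all [m.+1] variables stay in the first term. *)
Lemma comp_hom_symS m t x :
  comp_hom_sym t (fun i : 'I_m.+1 => x i) =
    x 0%N * comp_hom_sym (t - 1) (fun i : 'I_m.+1 => x i)
    + comp_hom_sym t (fun i : 'I_m => x i.+1).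
Proof.
have expand d : comp_hom_sym d (fun i : 'I_m.+1 => x i) =
    \sum_(e < d.+1) x 0%N ^+ e *
      comp_hom_sym (d - e)%N (fun i : 'I_m => x i.+1).
  rewrite [LHS]graded_sumS; apply: eq_big => [e|e _]; first by rewrite -ltnS ltn_ord.
  by rewrite graded_sum_ord_bound ?leq_subr.
case: t => [[|d]|d].
- by rewrite mulr0 add0r expand big_ord1 mul1r.
- rewrite -[in d.+1%:Z - 1]addn1 PoszD addrK !expand.
  (* The summands with positive exponent, shifted by one, are [x 0] times the expansion in degree
     [d]. *)
  rewrite big_ord_recl /= mul1r addrC; congr (_ + _).
  by rewrite mulr_sumr; apply: eq_bigr => e _; rewrite exprS mulrA.
- by rewrite mulr0 addr0.
Qed.

(** Each step consumes one variable: a horizontal step selects it, an up step skips it. This is the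
    recursion [elem_symS]. *)
Lemma elem_sym_path_sum m n x :
  elem_sym (m%:Z - n%:Z) (fun i : 'I_m => x i) = path_sum K (fun i _ => x i) m n.
Proof.
elim: m n x => [|m IH] n x; rewrite [RHS]/=.
  by rewrite elem_sym0; congr (_%:R); congr nat_of_bool; apply/eqP/eqP; lia.
case: n => [|n]; rewrite elem_symS -!IH; last first.
  by congr (_ * _ + _); congr elem_sym; lia.
(* For [n = 0] no up step is possible; the skipping term has degree [m.+1] in [m] variables and
   vanishes. *)
rewrite subr0 (elem_sym_large _ _ (fun i => x i.+1)) // addr0.
by congr (_ * _); congr elem_sym; lia.
Qed.

(** A horizontal step stays at its height and may reuse the variable; only an up step discards it.
    This is the recursion [comp_hom_symS]. *)
Lemma comp_hom_sym_path_sum m n x :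
  comp_hom_sym (m%:Z - n%:Z) (fun i : 'I_n.+1 => x i) =
  path_sum K (fun _ j => x j) m n.
Proof.
elim: m n x => [|m IH] [|n] x; rewrite [RHS]/=.
- by rewrite comp_hom_symS (comp_hom_sym0 _ (fun i => x i.+1)) mulr0 add0r.
- by rewrite sub0r -NegzE.
- rewrite comp_hom_symS (comp_hom_sym0 _ (fun i => x i.+1)) -IH.
  by rewrite addr0; congr (_ * _); congr comp_hom_sym; lia.
- rewrite comp_hom_symS -!IH.
  by congr (_ * _ + _); congr comp_hom_sym; lia.
Qed.
End SymmetricFunctions.

Theorem theorem6p1 (K : comPzRingType) (v w : int -> K) (al be : int)
    (m1 m2 n : nat) :
  stirling1 v w al be (m1 + m2) n =
    \sum_(0 <= k < n.+1)
      stirling1 v w (al + m2%:Z) be m1 (n - k) *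
      stirling1 v w al (be + m1%:Z) m2 k
  /\
  stirling2 v w al be (m1 + m2) n =
    \sum_(0 <= k < n.+1)
      stirling2 v w (al + k%:Z) be m1 (n - k) *
      stirling2 v w al (be + n%:Z - k%:Z) m2 k.
Proof.
(* The new index [j = n - k] is the height at the cut. *)
split; rewrite big_mkord (reindex_inj rev_ord_inj) /=.
- pose y i := v (al + (m1 + m2)%:Z - 1 - i%:Z) * w (be + i%:Z).
  rewrite [LHS](elem_sym_path_sum K (m1 + m2) n y) path_sum_cat.
  apply: eq_bigr => j _; rewrite subSS subKn -1?ltnS //.
  rewrite -(elem_sym_path_sum K m1 j y).
  rewrite -(elem_sym_path_sum K m2 (n - j) (fun a => y (m1 + a)%N)).
  by congr (_ * _); apply: eq_elem_sym => i; rewrite /y; congr (v _ * w _); lia.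
- pose y i := v (al + n%:Z - i%:Z) * w (be + i%:Z).
  rewrite [LHS](comp_hom_sym_path_sum K (m1 + m2) n y) path_sum_cat.
  apply: eq_bigr => j _; rewrite subSS subKn -1?ltnS //.
  rewrite -(comp_hom_sym_path_sum K m1 j y).
  (* The variable [y j] occurs in both factors, since horizontal steps at height [j] can lie on
     either side of the cut. *)
  rewrite -(comp_hom_sym_path_sum K m2 (n - j) (fun b => y (j + b)%N)).
  (* The bound makes the truncated [n - j] agree with the integer difference in the shifts. *)
  have jn := ltn_ord j.
  by congr (_ * _); apply: eq_comp_hom_sym => i; rewrite /y;
    congr (v _ * w _); lia.
Qed.
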